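(* The category $\mathbf{S4DMGrp}$ of S4 De Morgan groupoids and their homomorphisms is dually equivalent to the category $\mathbf{S4DMGrpSpec}$ of S4DMGrp-spaces and spectral frame morphisms.
   Context: A De Morgan algebra is a bounded distributive lattice $\langle A;\wedge,\vee,0,1\rangle$ with a unary operation $-$ such that $a\leq b$ implies $-b\leq -a$, and $--a=a$. An S4 De Morgan groupoid is an algebra $\langle A;\wedge,\vee,-,\cdot,\rightarrow,t,0,1,\nabla\rangle$ such that $\langle A;\wedge,\vee,-,0,1\rangle$ is a De Morgan algebra and, for all $a,b,c\in A$: $\nabla(a\vee b)=\nabla a\vee\nabla b$, $\nabla 0=0$, $a\leq\nabla a$, $\nabla\nabla a\leq\nabla a$; $t\cdot a=a$; $a\cdot 0=0\cdot a=0$; $a\cdot(b\vee c)=(a\cdot b)\vee(a\cdot c)$; $(a\vee b)\cdot c=(a\cdot c)\vee(b\cdot c)$; and $a\cdot b\leq c$ iff $a\leq b\rightarrow c$. Homomorphisms preserve all the operations $\wedge,\vee,-,\cdot,\rightarrow,t,0,1,\nabla$. For a topological space $X$, $\Omega(X)$ is the set of compact open subsets of $X$, and the specialization order is: $x\leqslant y$ iff every open set containing $x$ contains $y$. A spectral space is a compact, $T_0$, sober space $X$ such that $\Omega(X)$ is closed under finite intersections and is a basis for $X$ (sober: every completely prime filter of the lattice of open sets is the set of open neighbourhoods of some point). A map $f\colon X\to Y$ of spectral spaces is a spectral map if $f^{-1}[U]\in\Omega(X)$ for each $U\in\Omega(Y)$. Given $g\colon X\to X$, $R\subseteq X^2$,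 $S\subseteq X^3$ and $U,V\subseteq X$ let $U^*=\{x: g(x)\notin U\}$, $\nabla_RU=R[U]=\{y:\exists x\in U,\ xRy\}$, $U\circ V=\{z:\exists x,y\,(Sxyz,\ x\in U,\ y\in V)\}$, $U\rightarrow V=\{x:\forall y,z\,((Sxyz\ \text{and}\ y\in U)\Rightarrow z\in V)\}$. An S4DMGrp-space is $\langle X;g,S,R,\Theta,\tau\rangle$, with $\Theta\subseteq X$, such that: $\langle X;\tau\rangle$ is a spectral space; $g$ is an order-inverting involution for $\leqslant$; $R$ is reflexive and transitive; for $U,V\in\Omega(X)$ the sets $U^*,\nabla_RU,U\circ V,U\rightarrow V$ are in $\Omega(X)$; if not $xRy$, there is $U\in\Omega(X)$ with $x\in U$, $y\notin\nabla_RU$; $Sxyz$, $x'\leqslant x$, $y'\leqslant y$, $z\leqslant z'$ imply $Sx'y'z'$; if not $Sxyz$, there are $U,V\in\Omega(X)$ with $x\in U$, $y\in V$, $z\notin U\circ V$; and $\Theta\in\Omega(X)$ with, for all $y,z$: $y\leqslant z$ iff there is $x\in\Theta$ with $Sxyz$. A spectral frame morphism between S4DMGrp-spaces $X$ and $X'$ is a function $f\colon X\to X'$ such that: (1) $f$ is a spectral map; (2) $f^{-1}[\Theta']=\Theta$ and $f(g(x))=g(f(x))$; (3) $Sxyz$ implies $S'f(x)f(y)f(z)$; (4) $S'x'y'f(z)$ implies there are $x,y\in X$ with $Sxyz$, $x'\leqslant f(x)$, $y'\leqslant f(y)$; (5) $S'f(x)y'z'$ implies there are $y,z\in X$ with $Sxyz$,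 $y'\leqslant f(y)$, $f(z)\leqslant z'$; (6) $f^{-1}[\nabla_RU]=\nabla_Rf^{-1}[U]$ for all $U\in\Omega(X')$. *)

(* Defs.v *)
From HB Require Import structures.
From mathcomp Require Import all_boot all_order.
From mathcomp Require Import boolp classical_sets filter topology.

Set Implicit Arguments.
Unset Strict Implicit.
Unset Printing Implicit Defensive.

Import Order.Theory.

Local Open Scope classical_set_scope.

(* [comp f g] is the composite "first [f], then [g]". *)
Record category := Category {
  obj :> Type;
  hom : obj -> obj -> Type;
  idm : forall x, hom x x;
  comp : forall x y z, hom x y -> hom y z -> hom x z;
  comp1m : forall x y (f : hom x y), comp (idm x) f = f;
  compm1 : forall x y (f : hom x y), comp f (idm y) = f;
  compA : forall x y z w (f : hom x y) (g : hom y z) (h : hom z w),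
    comp f (comp g h) = comp (comp f g) h
}.
Arguments hom {c} x y : rename.
Arguments idm {c} x : rename.
Arguments comp {c x y z} f g : rename.
Arguments comp1m {c x y} f : rename.
Arguments compm1 {c x y} f : rename.
Arguments compA {c x y z w} f g h : rename.

Definition opposite (C : category) : category :=
  @Category C (fun x y => hom y x) (fun x => idm x)
    (fun x y z f g => comp g f)
    (fun x y f => compm1 f) (fun x y f => comp1m f)
    (fun x y z w f g h => esym (compA h g f)).

Record functor (C D : category) := Functor {
  fobj :> C -> D;
  fmap : forall x y, hom x y -> hom (fobj x) (fobj y);
  fmap1 : forall x, fmap (idm x) = idm (fobj x);
  fmapM : forall x y z (f : hom x y) (g : hom y z),
    fmap (comp f g) = comp (fmap f) (fmap g)
}.
Arguments fmap {C D} f {x y} h : rename.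
Arguments fmap1 {C D} f x : rename.
Arguments fmapM {C D} f {x y z} h k : rename.

Definition functor_id (C : category) : functor C C :=
  @Functor C C (fun x => x) (fun x y f => f) (fun=> erefl)
    (fun x y z f g => erefl).

Definition functor_comp (C D E : category) (F : functor C D)
    (G : functor D E) : functor C E :=
  @Functor C E (fun x => G (F x)) (fun x y f => fmap G (fmap F f))
    (fun x => etrans (congr1 (fmap G) (fmap1 F x)) (fmap1 G (F x)))
    (fun x y z f g =>
       etrans (congr1 (fmap G) (fmapM F f g)) (fmapM G (fmap F f) (fmap F g))).

Record natural_iso (C D : category) (F G : functor C D) := NaturalIso {
  niso : forall x, hom (F x) (G x);
  niso_inv : forall x, hom (G x) (F x);
  nisoK : forall x, comp (niso x) (niso_inv x) = idm (F x);
  niso_invK : forall x, comp (niso_inv x) (niso x) = idm (G x);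
  niso_natural : forall x y (f : hom x y),
    comp (fmap F f) (niso y) = comp (niso x) (fmap G f)
}.

Definition equivalent (C D : category) : Prop :=
  exists (F : functor C D) (G : functor D C),
    inhabited (natural_iso (functor_comp F G) (functor_id C)) /\
    inhabited (natural_iso (functor_comp G F) (functor_id D)).

Definition dually_equivalent (C D : category) : Prop :=
  equivalent (opposite C) D.

Definition de_morgan d (A : tbDistrLatticeType d) (neg : A -> A) : Prop :=
  {homo neg : a b / (a <= b)%O >-> (b <= a)%O} /\ involutive neg.

(* The constants 0 and 1 are the [\bot] and [\top] of the underlying bounded
   distributive lattice, which may coincide. *)
Record s4dm_groupoid := S4DMGroupoid {
  s4dm_disp : Order.disp_t;
  s4dm_lattice :> tbDistrLatticeType s4dm_disp;
  s4neg : s4dm_lattice -> s4dm_lattice;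
  s4mul : s4dm_lattice -> s4dm_lattice -> s4dm_lattice;
  s4imp : s4dm_lattice -> s4dm_lattice -> s4dm_lattice;
  s4t : s4dm_lattice;
  s4nabla : s4dm_lattice -> s4dm_lattice;
  s4negP : de_morgan s4neg;
  s4nablaU : {morph s4nabla : a b / (a `|` b)%O};
  s4nabla0 : s4nabla \bot%O = \bot%O;
  s4nabla_ge : forall a, (a <= s4nabla a)%O;
  s4nabla_nabla : forall a, (s4nabla (s4nabla a) <= s4nabla a)%O;
  s4mul_tl : left_id s4t s4mul;
  s4mul_0r : right_zero \bot%O s4mul;
  s4mul_0l : left_zero \bot%O s4mul;
  s4mul_Ur : right_distributive s4mul Order.join;
  s4mul_Ul : left_distributive s4mul Order.join;
  s4residuation : forall a b c, (s4mul a b <= c)%O <-> (a <= s4imp b c)%O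
}.
Arguments s4neg {s} a : rename.
Arguments s4mul {s} a b : rename.
Arguments s4imp {s} a b : rename.
Arguments s4t {s}.
Arguments s4nabla {s} a : rename.

Record is_s4dm_hom (A B : s4dm_groupoid) (h : A -> B) : Prop := IsS4DMHom {
  s4hom_meet : {morph h : a b / (a `&` b)%O};
  s4hom_join : {morph h : a b / (a `|` b)%O};
  s4hom_neg : {morph h : a / s4neg a};
  s4hom_mul : {morph h : a b / s4mul a b};
  s4hom_imp : {morph h : a b / s4imp a b};
  s4hom_t : h s4t = s4t;
  s4hom_bot : h \bot%O = \bot%O;
  s4hom_top : h \top%O = \top%O;
  s4hom_nabla : {morph h : a / s4nabla a}
}.

Record s4dm_hom (A B : s4dm_groupoid) := S4DMHom {
  s4dm_hom_fun :> A -> B;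
  s4dm_homP : is_s4dm_hom s4dm_hom_fun
}.

Lemma s4dm_hom_ext (A B : s4dm_groupoid) (f g : s4dm_hom A B) :
  (f : A -> B) = g -> f = g.
Proof.
by case: f g => f fP [g gP] /= fg; subst g; rewrite (Prop_irrelevance fP gP).
Qed.

Lemma is_s4dm_hom_id (A : s4dm_groupoid) : is_s4dm_hom (@id A).
Proof. by split. Qed.

Lemma is_s4dm_hom_comp (A B C : s4dm_groupoid) (f : A -> B) (g : B -> C) :
  is_s4dm_hom f -> is_s4dm_hom g -> is_s4dm_hom (g \o f).
Proof.
move=> fP gP; split=> [a b|a b|a|a b|a b||||a] /=.
- by rewrite (s4hom_meet fP) (s4hom_meet gP).
- by rewrite (s4hom_join fP) (s4hom_join gP).
- by rewrite (s4hom_neg fP) (s4hom_neg gP).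
- by rewrite (s4hom_mul fP) (s4hom_mul gP).
- by rewrite (s4hom_imp fP) (s4hom_imp gP).
- by rewrite (s4hom_t fP) (s4hom_t gP).
- by rewrite (s4hom_bot fP) (s4hom_bot gP).
- by rewrite (s4hom_top fP) (s4hom_top gP).
- by rewrite (s4hom_nabla fP) (s4hom_nabla gP).
Qed.

Definition s4dm_id (A : s4dm_groupoid) : s4dm_hom A A :=
  S4DMHom (is_s4dm_hom_id A).

Definition s4dm_comp (A B C : s4dm_groupoid) (f : s4dm_hom A B)
    (g : s4dm_hom B C) : s4dm_hom A C :=
  S4DMHom (is_s4dm_hom_comp (s4dm_homP f) (s4dm_homP g)).

Definition S4DMGrp : category.
Proof.
refine (@Category s4dm_groupoid s4dm_hom s4dm_id s4dm_comp _ _ _);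
  by move=> *; exact: s4dm_hom_ext.
Defined.

Definition compact_open_sets (X : topologicalType) : set (set X) :=
  [set U | compact U /\ open U].
Arguments compact_open_sets X : clear implicits.

Definition spec_le (X : topologicalType) (x y : X) : Prop :=
  forall U : set X, open U -> U x -> U y.

(* Taking [G] empty in [cpf_prime] shows that [set0] is not in [F]: completely
   prime filters are proper. *)
Record completely_prime_filter (X : topologicalType) (F : set (set X)) :
    Prop := CompletelyPrimeFilter {
  cpf_open : F `<=` open;
  cpf_setT : F setT;
  cpf_setI : setI_closed F;
  cpf_up : forall U V : set X, F U -> open V -> U `<=` V -> F V;
  cpf_prime : forall G : set (set X), G `<=` open ->
    F (\bigcup_(U in G) U) -> exists2 U, G U & F U
}.

Definition sober (X : topologicalType) : Prop :=
  forall F : set (set X), completely_prime_filter F ->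
    exists x : X, F = [set U | open U /\ U x].

Record spectral_space (X : topologicalType) : Prop := SpectralSpace {
  spectral_compact : compact [set: X];
  spectral_T0 : kolmogorov_space X;
  spectral_sober : sober X;
  spectral_setI : setI_closed (compact_open_sets X);
  spectral_basis : basis (compact_open_sets X)
}.

Definition spectral_map (X Y : topologicalType) (f : X -> Y) : Prop :=
  forall U : set Y, compact_open_sets Y U -> compact_open_sets X (f @^-1` U).

Section SetOperations.
Variables (X : Type) (g : X -> X) (R : X -> X -> Prop) (S : X -> X -> X -> Prop).
Implicit Types U V : set X.

Definition set_star U : set X := [set x | ~ U (g x)].

Definition set_nabla U : set X := [set y | exists2 x, U x & R x y].

Definition set_fusion U V : set X :=
  [set z | exists x y, [/\ S x y z, U x & V y]].

Definition set_imp U V : set X :=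
  [set x | forall y z, S x y z /\ U y -> V z].

End SetOperations.

Record s4dm_space := S4DMSpace {
  s4sp_top :> topologicalType;
  s4g : s4sp_top -> s4sp_top;
  s4S : s4sp_top -> s4sp_top -> s4sp_top -> Prop;
  s4R : s4sp_top -> s4sp_top -> Prop;
  s4Theta : set s4sp_top;
  s4sp_spectral : spectral_space s4sp_top;
  s4g_inv : involutive s4g;
  s4g_le : forall x y, spec_le x y -> spec_le (s4g y) (s4g x);
  s4R_refl : forall x, s4R x x;
  s4R_trans : forall x y z, s4R x y -> s4R y z -> s4R x z;
  s4sp_star : forall U, compact_open_sets s4sp_top U ->
    compact_open_sets s4sp_top (set_star s4g U);
  s4sp_nabla : forall U, compact_open_sets s4sp_top U ->
    compact_open_sets s4sp_top (set_nabla s4R U);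
  s4sp_fusion : forall U V, compact_open_sets s4sp_top U ->
    compact_open_sets s4sp_top V ->
    compact_open_sets s4sp_top (set_fusion s4S U V);
  s4sp_imp : forall U V, compact_open_sets s4sp_top U ->
    compact_open_sets s4sp_top V ->
    compact_open_sets s4sp_top (set_imp s4S U V);
  s4R_sep : forall x y, ~ s4R x y ->
    exists U, [/\ compact_open_sets s4sp_top U, U x & ~ set_nabla s4R U y];
  s4S_le : forall x y z x' y' z', s4S x y z ->
    spec_le x' x -> spec_le y' y -> spec_le z z' -> s4S x' y' z';
  s4S_sep : forall x y z, ~ s4S x y z ->
    exists U V, [/\ compact_open_sets s4sp_top U, compact_open_sets s4sp_top V,
                    U x, V y & ~ set_fusion s4S U V z];
  s4Theta_co : compact_open_sets s4sp_top s4Theta;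
  s4ThetaP : forall y z, spec_le y z <-> exists2 x, s4Theta x & s4S x y z
}.
Arguments s4g {s} x : rename.
Arguments s4S {s} x y z : rename.
Arguments s4R {s} x y : rename.
Arguments s4Theta s : clear implicits.

Record is_spectral_frame_mor (X Y : s4dm_space) (f : X -> Y) : Prop :=
    IsSpectralFrameMor {
  sfm_spectral : spectral_map f;
  sfm_Theta : f @^-1` s4Theta Y = s4Theta X;
  sfm_g : forall x, f (s4g x) = s4g (f x);
  sfm_S : forall x y z, s4S x y z -> s4S (f x) (f y) (f z);
  sfm_S_back : forall x' y' z, s4S x' y' (f z) ->
    exists x y, [/\ s4S x y z, spec_le x' (f x) & spec_le y' (f y)];
  sfm_S_forth : forall x y' z', s4S (f x) y' z' ->
    exists y z, [/\ s4S x y z, spec_le y' (f y) & spec_le (f z) z'];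
  sfm_nabla : forall U, compact_open_sets Y U ->
    f @^-1` (set_nabla s4R U) = set_nabla s4R (f @^-1` U)
}.

Record spectral_frame_mor (X Y : s4dm_space) := SpectralFrameMor {
  sfm_fun :> X -> Y;
  sfmP : is_spectral_frame_mor sfm_fun
}.

Lemma spectral_frame_mor_ext (X Y : s4dm_space) (f g : spectral_frame_mor X Y) :
  (f : X -> Y) = g -> f = g.
Proof.
by case: f g => f fP [g gP] /= fg; subst g; rewrite (Prop_irrelevance fP gP).
Qed.

Lemma spec_le_trans (X : topologicalType) (x y z : X) :
  spec_le x y -> spec_le y z -> spec_le x z.
Proof. by move=> xy yz U oU /(xy U oU)/(yz U oU). Qed.

Lemma spectral_map_le (X Y : topologicalType) (f : X -> Y) :
  spectral_space Y -> spectral_map f ->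
  forall x y, spec_le x y -> spec_le (f x) (f y).
Proof.
move=> sY sf x y xy U oU Ufx.
have [_ /(_ (f x) U)] := spectral_basis sY.
case; first by apply: open_nbhs_nbhs; split.
move=> V [/= coV Vfx] VU; apply: VU.
by have [_ oV] := sf _ coV; exact: (xy _ oV).
Qed.

Lemma is_spectral_frame_mor_id (X : s4dm_space) :
  is_spectral_frame_mor (@id X).
Proof.
split=> // [x' y' z Sz|x y' z' Sz].
  by exists x', y'; split.
by exists y', z'; split.
Qed.

Lemma is_spectral_frame_mor_comp (X Y Z : s4dm_space) (f : X -> Y)
    (h : Y -> Z) : is_spectral_frame_mor f -> is_spectral_frame_mor h ->
  is_spectral_frame_mor (h \o f).
Proof.
move=> fP hP.
have h_le := spectral_map_le (s4sp_spectral Z) (sfm_spectral hP).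
split=> [U coU||x|x y z Sxyz|x2 y2 z Sz|x y2 z2 Sx|U coU].
- exact: (sfm_spectral fP (sfm_spectral hP coU)).
- by rewrite comp_preimage (sfm_Theta hP) (sfm_Theta fP).
- by rewrite /= (sfm_g fP) (sfm_g hP).
- exact: (sfm_S hP (sfm_S fP Sxyz)).
- have [x1 [y1 [S1 x21 y21]]] := sfm_S_back hP Sz.
  have [x [y [S0 x10 y10]]] := sfm_S_back fP S1.
  exists x, y; split=> //.
    exact: spec_le_trans x21 (h_le _ _ x10).
  exact: spec_le_trans y21 (h_le _ _ y10).
- have [y1 [z1 [S1 y21 z12]]] := sfm_S_forth hP Sx.
  have [y [z [S0 y10 z01]]] := sfm_S_forth fP S1.
  exists y, z; split=> //.
    exact: spec_le_trans y21 (h_le _ _ y10).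
  exact: spec_le_trans (h_le _ _ z01) z12.
- rewrite comp_preimage (sfm_nabla hP coU) (sfm_nabla fP) //.
  exact: sfm_spectral hP _ coU.
Qed.

Definition spectral_frame_mor_id (X : s4dm_space) : spectral_frame_mor X X :=
  SpectralFrameMor (is_spectral_frame_mor_id X).

Definition spectral_frame_mor_comp (X Y Z : s4dm_space)
    (f : spectral_frame_mor X Y) (h : spectral_frame_mor Y Z) :
    spectral_frame_mor X Z :=
  SpectralFrameMor (is_spectral_frame_mor_comp (sfmP f) (sfmP h)).

Definition S4DMGrpSpec : category.
Proof.
refine (@Category s4dm_space spectral_frame_mor spectral_frame_mor_id
  spectral_frame_mor_comp _ _ _);
  by move=> *; exact: spectral_frame_mor_ext.
Defined.

(* Main.v *)
From HB Require Import structures.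
Require Import Defs.
From mathcomp Require Import all_boot all_order.
From mathcomp Require Import boolp classical_sets filter topology.

(* Priestley-Stone duality with relations. The dual space of an algebra A is
   its set of prime filters, with the topology generated by the sets
   {x | a in x}; these sets are exactly the compact opens, so A is recovered
   from its dual space. The operations become g x = {a | -a notin x},
   S x y z iff x . y is contained in z, and x R y iff nabla[x] is contained
   in y. That compact opens correspond to the algebraic operations, and that
   the inverse image under a homomorphism is back-and-forth for S, comes from
   extending filters F, G with F . G contained in a prime filter z to prime
   filters with the same property: for each argument in turn, the elements
   with which the product leaves z form an ideal. Conversely a point x of a
   space goes to the prime filter of its compact open neighbourhoods; this is
   injective by T0, surjective by sobriety, and the separation axioms of the
   space make it reflect R and S. *)

Set Implicit Arguments.
Unset Strict Implicit.
Unset Printing Implicit Defensive.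

Import Order.Theory.

Local Open Scope classical_set_scope.

(** * Prime filter separation *)

Section LatticeFilters.
Context (d : Order.disp_t) (A : tbDistrLatticeType d).
Implicit Types (a b c : A) (F I P : set A).

Record lattice_filter F : Prop := LatticeFilter {
  lfilter_top : F \top%O;
  lfilter_meet : forall a b, F a -> F b -> F (a `&` b)%O;
  lfilter_up : forall a b, (a <= b)%O -> F a -> F b
}.

Record lattice_ideal I : Prop := LatticeIdeal {
  lideal_bot : I \bot%O;
  lideal_join : forall a b, I a -> I b -> I (a `|` b)%O;
  lideal_down : forall a b, (a <= b)%O -> I b -> I a
}.

Record prime_filter P : Prop := PrimeFilter {
  pfilter_filter : lattice_filter P;
  pfilter_bot : ~ P \bot%O;
  pfilter_join : forall a b, P (a `|` b)%O -> P a \/ P b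
}.

Lemma principal_lattice_filter a : lattice_filter [set c | (a <= c)%O].
Proof.
split=> [|b c|b c] /=; first exact: lex1.
  by rewrite lexI => -> ->.
by move=> bc ab; exact: le_trans ab bc.
Qed.

(** By Zorn, some filter is maximal among those that contain [F] and miss [I]; distributivity makes
    it prime. *)
Lemma prime_filter_separation F I : lattice_filter F -> lattice_ideal I ->
  (forall a, F a -> ~ I a) ->
  exists P, [/\ prime_filter P, F `<=` P & forall a, P a -> ~ I a].
Proof.
move=> fF iI FI0.
(* The union with [F] makes the statement true of the empty chain. *)
pose Q G := lattice_filter (F `|` G) /\ forall a, (F `|` G) a -> ~ I a.
have [K KQ totK|M [[fM MI0] maxM]] := @Zorn_bigcup A Q.
  split.
    split=> [|a b|a b ab].
    - by left; exact: lfilter_top fF.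
    - case=> [Fa|[G KG Ga]] [Fb|[H KH Hb]].
      + by left; exact: lfilter_meet fF _ _ Fa Fb.
      + have [HF _] := KQ _ KH.
        by have [] := lfilter_meet HF (or_introl Fa) (or_intror Hb);
          [left|right; exists H].
      + have [HF _] := KQ _ KG.
        by have [] := lfilter_meet HF (or_intror Ga) (or_introl Fb);
          [left|right; exists G].
      + have [GH|HG] := totK _ _ KG KH.
          have [HF _] := KQ _ KH.
          by have [] := lfilter_meet HF (or_intror (GH _ Ga)) (or_intror Hb);
            [left|right; exists H].
        have [HF _] := KQ _ KG.
        by have [] := lfilter_meet HF (or_intror Ga) (or_intror (HG _ Hb));
          [left|right; exists G].
    - case=> [Fa|[G KG Ga]]; first by left; exact: lfilter_up fF _ _ ab Fa.
      have [HF _] := KQ _ KG.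
      by have [] := lfilter_up HF ab (or_intror Ga); [left|right; exists G].
  move=> a [/FI0//|[G KG Ga]].
  by have [_] := KQ _ KG; apply; right.
pose N := F `|` M.
(* Maximality: the filter [H] generated by [N] and an outside element [a] has to meet [I]. *)
have meetI a : ~ N a -> exists m i, [/\ N m, I i & (m `&` a <= i)%O].
  move=> Na; apply: contrapT => nI.
  pose H := [set c | exists2 m, N m & (m `&` a <= c)%O].
  have NH : N `<=` H by move=> c Nc; exists c => //; exact: leIl.
  have FH : F `|` H = H.
    by apply/setUidPr => c Fc; apply: NH; left.
  apply: (maxM H).
    split; first by move=> c Mc; apply: NH; right.
    move=> HM; apply: Na; right; apply: HM.
    by exists \top%O; [exact: lfilter_top fM|exact: leIr].
  rewrite /Q FH; split; last first.
    by move=> i [m Nm mi] Ii; apply: nI; exists m, i.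
  split=> [|b c [m Nm mb] [n Nn nc]|b c bc [m Nm mb]].
  - by exists \top%O; [exact: lfilter_top fM|exact: lex1].
  - exists (m `&` n)%O; first exact: lfilter_meet fM _ _ Nm Nn.
    by rewrite lexI (le_trans _ mb) ?(le_trans _ nc) // leI2 // ?leIl ?leIr.
  - by exists m => //; exact: le_trans mb bc.
exists N; split; [|by move=> a Fa; left|exact: MI0].
split=> // [N0|a b Nab]; first exact: MI0 N0 (lideal_bot iI).
(* If neither [a] nor [b] were in [N], distributivity would put an element of [N] below the join of
   [i] and [j], hence in [I]. *)
apply: contrapT => /not_orP[/meetI[m [i [Nm Ii mi]]] /meetI[n [j [Nn Ij nj]]]].
apply: (MI0 ((m `&` n) `&` (a `|` b))%O).
  by apply: (lfilter_meet fM) => //; exact: lfilter_meet.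
apply: (lideal_down iI _ (lideal_join iI Ii Ij)).
rewrite meetUr leU2 //.
  by rewrite (le_trans _ mi) // leI2 // leIl.
by rewrite (le_trans _ nj) // leI2 // leIr.
Qed.

End LatticeFilters.

(** * The spectrum of a bounded distributive lattice *)

Record spectrum (d : Order.disp_t) (A : tbDistrLatticeType d) := Spectrum {
  spectrum_set :> A -> Prop;
  spectrumP : prime_filter spectrum_set
}.

HB.instance Definition _ d (A : tbDistrLatticeType d) :=
  gen_eqMixin (spectrum A).
HB.instance Definition _ d (A : tbDistrLatticeType d) :=
  gen_choiceMixin (spectrum A).

Definition stone d (A : tbDistrLatticeType d) (a : A) : set (spectrum A) :=
  [set x | x a].

Section SpectrumTheory.
Context (d : Order.disp_t) (A : tbDistrLatticeType d).
Implicit Types (a b c : A) (x y z : spectrum A).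

Lemma spectrum_ext x y : (forall a, x a <-> y a) -> x = y.
Proof.
case: x y => P pP [Q pQ] /= PQ.
have {}PQ : P = Q by apply/funext => a; exact/propext.
by subst Q; rewrite (Prop_irrelevance pP pQ).
Qed.

Lemma spectrum_top x : x \top%O.
Proof. exact: lfilter_top (pfilter_filter (spectrumP x)). Qed.

Lemma spectrum_bot x : ~ x \bot%O.
Proof. exact: pfilter_bot (spectrumP x). Qed.

Lemma spectrum_up x a b : (a <= b)%O -> x a -> x b.
Proof. exact: lfilter_up (pfilter_filter (spectrumP x)) a b. Qed.

Lemma spectrum_meet x a b : x (a `&` b)%O <-> x a /\ x b.
Proof.
split=> [xab|[xa xb]].
  split; first exact: spectrum_up (leIl _ _) xab.
  exact: spectrum_up (leIr _ _) xab.
exact: lfilter_meet (pfilter_filter (spectrumP x)) _ _ xa xb.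
Qed.

Lemma spectrum_join x a b : x (a `|` b)%O <-> x a \/ x b.
Proof.
split; first exact: pfilter_join (spectrumP x) a b.
by case; apply: spectrum_up; [exact: leUl|exact: leUr].
Qed.

Lemma spectrum_separation (F I : set A) : lattice_filter F ->
  lattice_ideal I -> (forall a, F a -> ~ I a) ->
  exists x : spectrum A, F `<=` x /\ forall a, x a -> ~ I a.
Proof.
move=> fF iI FI; have [P [pP FP PI]] := prime_filter_separation fF iI FI.
by exists (Spectrum pP).
Qed.

(** An ideal is a down-set, so missing [a] it misses the whole principal filter of [a], and
    separation applies. *)
Lemma spectrum_avoid (I : set A) a : lattice_ideal I -> ~ I a ->
  exists2 x : spectrum A, x a & forall b, x b -> ~ I b.
Proof.
move=> iI Ia.
have [|x [ax xI]] := spectrum_separation (principal_lattice_filter a) iI.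
  by move=> b /= ab Ib; apply: Ia; exact: lideal_down iI _ _ ab Ib.
by exists x => //; apply: ax => /=.
Qed.

Lemma stoneT : stone \top%O = [set: spectrum A].
Proof. by apply/seteqP; split=> // x _; exact: spectrum_top. Qed.

Lemma stone0 : stone \bot%O = set0 :> set (spectrum A).
Proof. by rewrite -subset0 => x /spectrum_bot. Qed.

Lemma stoneI a b : stone (a `&` b)%O = stone a `&` stone b.
Proof. by apply/seteqP; split=> x /spectrum_meet. Qed.

Lemma stoneU a b : stone (a `|` b)%O = stone a `|` stone b.
Proof. by apply/seteqP; split=> x /spectrum_join. Qed.

(** If [a] is not below [b], some prime filter through [a] avoids the principal ideal of [b]. *)
Lemma stone_le a b : stone a `<=` stone b -> (a <= b)%O.
Proof.
move=> ab; apply: contrapT => nab.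
have [|x xa /(_ b)] := @spectrum_avoid [set c | (c <= b)%O] a _ nab.
  split=> [|c e /= cb eb|c e ce /= eb]; first exact: le0x.
    by rewrite leUx cb eb.
  exact: le_trans ce eb.
by apply=> //=; exact: (ab x xa).
Qed.

Lemma stone_inj : injective (@stone d A).
Proof.
by move=> a b ab; apply/le_anti/andP; split; apply: stone_le; rewrite ab.
Qed.

(** Unions of sets [stone a], described pointwise; as these sets are closed under finite
    intersections, such unions already form a topology. *)
Definition spectrum_open (U : set (spectrum A)) : Prop :=
  forall x, U x -> exists2 a, x a & stone a `<=` U.

Lemma spectrum_openT : spectrum_open setT.
Proof. by move=> x _; exists \top%O => //; exact: spectrum_top. Qed.

Lemma spectrum_openI : setI_closed spectrum_open.
Proof.
move=> U V oU oV x [/oU[a xa aU] /oV[b xb bV]].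
exists (a `&` b)%O; first by rewrite spectrum_meet.
by rewrite stoneI; exact: setISS.
Qed.

Lemma spectrum_open_bigU (I : Type) (f : I -> set (spectrum A)) :
  (forall i, spectrum_open (f i)) -> spectrum_open (\bigcup_i f i).
Proof.
move=> of_ x [i _ /of_[a xa af]]; exists a => // y /af fy.
by exists i.
Qed.

End SpectrumTheory.

HB.instance Definition _ d (A : tbDistrLatticeType d) :=
  isOpenTopological.Build (spectrum A)
    (@spectrum_openT d A) (@spectrum_openI d A) (@spectrum_open_bigU d A).

(* [compact_cover] needs a pointed space, whereas spectra may be empty. *)
Lemma compact_directed_cover (X : topologicalType) (V : set X)
    (J : set (set X)) : compact V -> J `<=` open -> J !=set0 ->
  (forall U W, J U -> J W -> exists2 Z, J Z & U `|` W `<=` Z) ->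
  V `<=` \bigcup_(U in J) U -> exists2 U, J U & V `<=` U.
Proof.
move=> cV oJ [U0 JU0] dirJ VJ; apply: contrapT => nV.
(* If no member of [J] contains [V], the remainders of [V] outside members of [J] generate a proper
   filter, by directedness. A cluster point of it in [V] lies in some open [U] of [J], which is
   disjoint from the remainder outside [U]. *)
pose F : set_system X := [set Z | exists2 U, J U & V `\` U `<=` Z].
have pF : ProperFilter F.
  apply: Build_ProperFilter_ex.
    move=> Z [U JU UZ]; apply: contrapT => nZ; apply: nV; exists U => // x Vx.
    by apply: contrapT => Ux; apply: nZ; exists x; apply: UZ.
  split=> [|P Q [U JU UP] [W JW WQ]|P Q PQ [U JU UP]].
  - by exists U0.
  - have [Z JZ UWZ] := dirJ _ _ JU JW; exists Z => // x [Vx Zx].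
    by split; [apply: UP|apply: WQ]; split=> // ?; apply: Zx; apply: UWZ;
      [left|right].
  - by exists U => // x /UP/PQ.
have FV : F V by exists U0 => // x [].
have [p [Vp clp]] := cV F pF FV.
have [U JU Up] := VJ _ Vp.
have FVU : F (V `\` U) by exists U.
have nU : nbhs p U by apply: open_nbhs_nbhs; split=> //; exact: oJ.
by have [x [[_ ?] ?]] := clp _ _ FVU nU.
Qed.

(** * Compact opens and sobriety of the spectrum *)

Section SpectrumSpectral.
Context (d : Order.disp_t) (A : tbDistrLatticeType d).
Implicit Types (a b c : A) (x y z : spectrum A).

Lemma stone_open a : open (stone a).
Proof. by move=> x xa; exists a. Qed.
Arguments stone_open : clear implicits.

(** The elements whose basic set has its complement in [F] form an ideal missing [a]. A point
    through [a] that avoids this ideal is a cluster point of [F]: each of its basic neighbourhoods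
    meets every member of [F]. *)
Lemma stone_compact a : compact (stone a).
Proof.
move=> F pF Fa.
pose I := [set b | F (~` stone b)].
have iI : lattice_ideal I.
  split=> [|b c Fb Fc|b c bc]; rewrite /I /=.
  - by rewrite stone0 setC0; exact: filterT.
  - by rewrite stoneU setCU; exact: filterI.
  - by apply: filterS; apply: subsetC => x; exact: spectrum_up.
have [|x xa xI] := @spectrum_avoid d A I a iI.
  move=> Ia; apply: (@filter_not_empty _ F).
  by rewrite -(setICr (stone a)); exact: filterI.
exists x; split=> // Z N FZ [B [oB Bx BN]].
have [b xb bB] := oB _ Bx.
apply: contrapT => ZN; apply: (xI b xb); rewrite /I /=.
by apply: filterS FZ => y Zy yb; apply: ZN; exists y; split=> //; apply/BN/bB.
Qed.

Lemma stone_compact_open a : compact_open_sets (spectrum A) (stone a).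
Proof. by split; [exact: stone_compact|exact: stone_open]. Qed.

(** An open set is the union of the basic sets inside it, a family directed under joins, so
    compactness makes it one of them. *)
Lemma compact_open_stone (U : set (spectrum A)) :
  compact_open_sets (spectrum A) U -> exists a, U = stone a.
Proof.
move=> [cU oU].
pose J : set (set (spectrum A)) :=
  [set stone a | a in [set a | stone a `<=` U]].
have [|||x Ux|_ [a aU <-] Ua] := @compact_directed_cover _ U J cU.
- by move=> _ [a _ <-]; exact: stone_open.
- by exists (stone \bot%O), \bot%O => //=; rewrite stone0.
- move=> _ _ [a aU <-] [b bU <-]; exists (stone (a `|` b)%O).
    by exists (a `|` b)%O => //=; rewrite stoneU; rewrite subUset.
  by rewrite stoneU.
- by have [a xa aU] := oU _ Ux; exists (stone a) => //; exists a.
- by exists a; apply/seteqP.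
Qed.

Lemma spec_le_spectrum x y : spec_le x y <-> forall a, x a -> y a.
Proof.
split=> [xy a|xy U oU /oU[a xa aU]]; first exact: (xy _ (stone_open a)).
exact/aU/xy.
Qed.

(** The point sought consists of the [a] with [stone a] in [F]. Complete primeness is applied three
    times: to the empty family for properness, to two basic sets for primeness, and to the basic
    cover of an open set in [F] to find a basic set in [F] below it. *)
Lemma spectrum_sober : sober (spectrum A).
Proof.
move=> F cF; pose P := [set a | F (stone a)].
have pP : prime_filter P.
  split; first split=> [|a b Fa Fb|a b ab]; rewrite /P /=.
  - by rewrite stoneT; exact: cpf_setT cF.
  - by rewrite stoneI; exact: cpf_setI cF _ _ Fa Fb.
  - move=> Fa; apply: (cpf_up cF Fa (stone_open b)) => x.
    exact: spectrum_up.
  - by rewrite /P /= stone0 -(bigcup_set0 id) => /(cpf_prime cF)[].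
  - move=> a b; rewrite /P /= stoneU -bigcup2E => Fab.
    have [||U] := @cpf_prime _ _ cF [set stone a; stone b].
    + by move=> _ [] ->; exact: stone_open.
    + by rewrite bigcup_setU1 bigcup_set1 -bigcup2E.
    + by case=> ->; [left|right].
exists (Spectrum pP); apply/seteqP.
split=> [U FU|U [oU] /oU[a Pa aU]]; last first.
  exact: cpf_up cF _ _ Pa oU aU.
split; first exact: cpf_open cF _ FU.
have oU := cpf_open cF FU.
pose G : set (set (spectrum A)) :=
  [set stone a | a in [set a | stone a `<=` U]].
have [||_ [a aU <-] Fa] := cpf_prime cF (G := G).
- by move=> _ [a _ <-]; exact: stone_open.
- suff <- : U = \bigcup_(W in G) W by [].
  apply/seteqP; split=> [x Ux|x [_ [a aU <-]]]; last exact: aU.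
  by have [a xa aU] := oU _ Ux; exists (stone a) => //; exists a.
- exact: aU.
Qed.

Lemma spectrum_spectral : spectral_space (spectrum A).
Proof.
split.
- by rewrite -stoneT; exact: stone_compact.
- move=> x y /eqP xy; apply: contrapT => nxy; apply: xy.
  apply: spectrum_ext => a.
  split=> [xa|ya]; apply: contrapT => na; apply: nxy; exists (stone a).
    left; rewrite !inE; split=> //.
    by apply: open_nbhs_nbhs; split=> //; exact: stone_open.
  right; rewrite !inE; split=> //.
  by apply: open_nbhs_nbhs; split=> //; exact: stone_open.
- exact: spectrum_sober.
- move=> _ _ /compact_open_stone[a ->] /compact_open_stone[b ->].
  by rewrite -stoneI; exact: stone_compact_open.
- split=> [U []//|x N [B [oB Bx BN]]].
  have [a xa aB] := oB _ Bx.
  exists (stone a) => /=; first by split=> //; exact: stone_compact_open.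
  exact: subset_trans BN.
Qed.

End SpectrumSpectral.

(** * The dual space of an S4 De Morgan groupoid *)

Section DualSpace.
Context (A : s4dm_groupoid).
Implicit Types (a b c : A) (F G I : set A) (x y z : spectrum A).

Lemma s4mul_le a b c e :
  (a <= b)%O -> (c <= e)%O -> (s4mul a c <= s4mul b e)%O.
Proof.
move=> /join_r <- /join_r <-.
by rewrite s4mul_Ul !s4mul_Ur -joinA leUl.
Qed.

Lemma s4nabla_le a b : (a <= b)%O -> (s4nabla a <= s4nabla b)%O.
Proof. by move=> /join_r <-; rewrite s4nablaU leUl. Qed.

Definition spectrum_S x y z : Prop :=
  forall a b, x a -> y b -> z (s4mul a b).

Definition spectrum_R x y : Prop := forall a, x a -> y (s4nabla a).

Lemma s4neg_le_swap a b : (a <= s4neg b)%O -> (b <= s4neg a)%O.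
Proof.
have [negle negK] := s4negP A.
by move=> /negle; rewrite negK.
Qed.

Lemma s4negK : involutive (@s4neg A).
Proof. by have [] := s4negP A. Qed.

Lemma s4negU a b : s4neg (a `|` b)%O = (s4neg a `&` s4neg b)%O.
Proof.
have [negle _] := s4negP A.
apply/le_anti/andP; split; first by rewrite lexI !negle ?leUl ?leUr.
apply: s4neg_le_swap; rewrite leUx.
by apply/andP; split; apply: s4neg_le_swap; rewrite ?leIl ?leIr.
Qed.

Lemma s4negI a b : s4neg (a `&` b)%O = (s4neg a `|` s4neg b)%O.
Proof. by rewrite -[RHS]s4negK s4negU !s4negK. Qed.

Lemma s4neg0 : s4neg \bot%O = \top%O :> A.
Proof. by apply/le_anti; rewrite lex1 s4neg_le_swap ?le0x. Qed.

Lemma s4neg1 : s4neg \top%O = \bot%O :> A.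
Proof. by rewrite -s4neg0 s4negK. Qed.

(** Negation is a dual automorphism of the lattice, so it pulls [x] back to a prime ideal, whose
    complement is a prime filter. *)
Lemma spectrum_g_subproof x : prime_filter [set a | ~ x (s4neg a)].
Proof.
split; first split=> [|a b|a b ab] /=.
- by rewrite s4neg1; exact: spectrum_bot.
- by rewrite s4negI spectrum_join => xa xb [].
- by apply: contra_not; apply: spectrum_up; exact: (proj1 (s4negP A)).
- by rewrite /= s4neg0 => /(_ (spectrum_top x)).
- move=> a b /=; rewrite s4negU spectrum_meet => xab.
  by apply: contrapT => /not_orP[/contrapT xa /contrapT xb]; exact: xab.
Qed.

Definition spectrum_g x : spectrum A := Spectrum (spectrum_g_subproof x).

(** The [a] with a product [s4mul a b] outside [z] for some [b] in [G] form an ideal, as [z] is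
    prime and the product preserves joins on the left; this ideal misses [F]. *)
Lemma spectrum_mul_left F G z : lattice_filter F -> lattice_filter G ->
  (forall a b, F a -> G b -> z (s4mul a b)) ->
  exists2 x : spectrum A, F `<=` x &
    forall a b, x a -> G b -> z (s4mul a b).
Proof.
move=> fF fG FGz.
have [||x [Fx xI]] := @spectrum_separation _ A F
    [set a | exists2 b, G b & ~ z (s4mul a b)] fF.
- split=> [|a b [c Gc ac] [e Ge be]|a b ab [c Gc bc]].
  + exists \top%O; first exact: lfilter_top fG.
    by rewrite s4mul_0l; exact: spectrum_bot.
  (* The meet of the two witnesses serves both elements: products with it are smaller. *)
  + exists (c `&` e)%O; first exact: lfilter_meet fG _ _ Gc Ge.
    rewrite s4mul_Ul spectrum_join => -[] z1; [apply: ac|apply: be];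
      by apply: spectrum_up z1; rewrite s4mul_le// ?leIl ?leIr.
  + by exists c => // zac; apply: bc; apply: spectrum_up zac; exact: s4mul_le.
- by move=> a Fa [b Gb]; apply; exact: FGz.
exists x => // a b xa Gb; apply: contrapT => nz.
by apply: (xI a xa); exists b.
Qed.

(** Mirror image of [spectrum_mul_left], with joins preserved on the right. *)
Lemma spectrum_mul_right F G z : lattice_filter F -> lattice_filter G ->
  (forall a b, F a -> G b -> z (s4mul a b)) ->
  exists2 y : spectrum A, G `<=` y &
    forall a b, F a -> y b -> z (s4mul a b).
Proof.
move=> fF fG FGz.
have [||y [Gy yI]] := @spectrum_separation _ A G
    [set b | exists2 a, F a & ~ z (s4mul a b)] fG.
- split=> [|a b [c Fc ca] [e Fe eb]|a b ab [c Fc cb]].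
  + exists \top%O; first exact: lfilter_top fF.
    by rewrite s4mul_0r; exact: spectrum_bot.
  + exists (c `&` e)%O; first exact: lfilter_meet fF _ _ Fc Fe.
    rewrite s4mul_Ur spectrum_join => -[] z1; [apply: ca|apply: eb];
      by apply: spectrum_up z1; rewrite s4mul_le// ?leIl ?leIr.
  + by exists c => // zca; apply: cb; apply: spectrum_up zca; exact: s4mul_le.
- by move=> b Gb [a Fa]; apply; exact: FGz.
exists y => // a b Fa yb; apply: contrapT => nz.
by apply: (yI b yb); exists a.
Qed.

(** The left extension keeps products with all of [G] inside [z], so the right one can start from
    the prime filter just found. *)
Lemma spectrum_S_extend F G z : lattice_filter F -> lattice_filter G ->
  (forall a b, F a -> G b -> z (s4mul a b)) ->
  exists x y : spectrum A, [/\ spectrum_S x y z, F `<=` x & G `<=` y].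
Proof.
move=> fF fG /(spectrum_mul_left fF fG)[x Fx xGz].
have [y Gy xyz] :=
  spectrum_mul_right (pfilter_filter (spectrumP x)) fG xGz.
by exists x, y.
Qed.

(** Here [z] is chosen first: the products of [x] and [G] generate a filter missing [I], which
    extends to a prime [z] avoiding [I]. Then [G] is enlarged to [y] beneath this [z]. *)
Lemma spectrum_S_avoid x G I : lattice_filter G -> lattice_ideal I ->
  (forall a b, x a -> G b -> ~ I (s4mul a b)) ->
  exists y z : spectrum A,
    [/\ spectrum_S x y z, G `<=` y & forall c, z c -> ~ I c].
Proof.
move=> fG iI xGI; have fx := pfilter_filter (spectrumP x).
have [||z [Hz zI]] := @spectrum_separation _ A
    [set c | exists a b, [/\ x a, G b & (s4mul a b <= c)%O]] I _ iI.
- split=> [|c e [a [b [xa Gb abc]]] [a' [b' [xa' Gb' abc']]]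
          |c e ce [a [b [xa Gb abc]]]].
  + exists \top%O, \top%O; split; last exact: lex1.
      exact: spectrum_top.
    exact: lfilter_top fG.
  + exists (a `&` a')%O, (b `&` b')%O; split.
    * exact: lfilter_meet fx _ _ xa xa'.
    * exact: lfilter_meet fG _ _ Gb Gb'.
    * by rewrite lexI (le_trans _ abc) ?(le_trans _ abc') // s4mul_le//
        ?leIl ?leIr.
  + by exists a, b; split=> //; exact: le_trans ce.
- move=> c [a [b [xa Gb abc]]] Ic; apply: (xGI a b xa Gb).
  exact: lideal_down iI _ _ abc Ic.
have [|y Gy xyz] := spectrum_mul_right (z := z) fx fG.
  by move=> a b xa Gb; apply: Hz; exists a, b.
by exists y, z.
Qed.

Lemma spectrum_star a :
  set_star spectrum_g (stone a) = stone (s4neg a).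
Proof.
apply/seteqP; split=> x; first exact: contrapT.
by move=> xa; apply.
Qed.

(** Since [s4nabla] preserves finite joins, the [b] with [s4nabla b] outside [y] form an ideal; a
    prime filter through [a] avoiding it is a predecessor of [y]. *)
Lemma spectrum_nabla a :
  set_nabla spectrum_R (stone a) = stone (s4nabla a).
Proof.
apply/seteqP; split=> [y [x xa]|y ya]; first exact.
have [||x xa xI] := @spectrum_avoid _ A [set b | ~ y (s4nabla b)] a.
- split=> [|b c yb yc|b c bc] /=.
  + by rewrite s4nabla0; exact: spectrum_bot.
  + by rewrite s4nablaU spectrum_join => -[].
  + by apply: contra_not; apply: spectrum_up; exact: s4nabla_le.
- by apply.
by exists x => // b /xI /contrapT.
Qed.

(** If [z] contains the product of [a] and [b], it contains all products of their principal filters,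
    which therefore extend to suitable points. *)
Lemma spectrum_fusion a b :
  set_fusion spectrum_S (stone a) (stone b) = stone (s4mul a b).
Proof.
apply/seteqP; split=> [z [x [y [Sxyz xa yb]]]|z zab]; first exact: Sxyz.
have [|x [y [Sxyz xa yb]]] := spectrum_S_extend (z := z)
  (principal_lattice_filter a) (principal_lattice_filter b).
  by move=> c e ac be; apply: spectrum_up zab; exact: s4mul_le.
by exists x, y; split=> //; [apply: xa => /=|apply: yb => /=].
Qed.

(** When [s4imp a b] is not in [x], residuation keeps the products of [x] with elements above [a]
    from falling below [b]; [spectrum_S_avoid] then yields a counterexample to membership on the
    left. *)
Lemma spectrum_imp a b :
  set_imp spectrum_S (stone a) (stone b) = stone (s4imp a b).
Proof.
apply/seteqP; split=> x; last first.
  move=> xab y z [Sxyz ya]; apply: spectrum_up (Sxyz _ _ xab ya).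
  by apply/s4residuation.
move=> xab; apply: contrapT => nxab.
have [|c e xc ac|y [z [Sxyz ay zI]]] := @spectrum_S_avoid x
    [set c | (a <= c)%O] [set c | (c <= b)%O] (principal_lattice_filter a).
- split=> [|c e /= cb eb|c e /= ce eb]; first exact: le0x.
    by rewrite leUx cb.
  exact: le_trans ce eb.
- move=> ceb; apply: nxab; apply: spectrum_up xc.
  by apply/s4residuation; apply: le_trans ceb; exact: s4mul_le.
have ya : y a by apply: ay => /=.
by apply: (zI b) => //=; exact: (xab y z (conj Sxyz ya)).
Qed.

(** One direction is the unit law; for the other, the principal filter of [s4t] extends to a prime
    [x], since products of its elements with those of [y] stay in [z]. *)
Lemma spectrum_Theta y z :
  spec_le y z <-> exists2 x, stone s4t x & spectrum_S x y z.
Proof.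
rewrite spec_le_spectrum; split=> [yz|[x xt Sxyz] b yb]; last first.
  by rewrite -(s4mul_tl b); exact: Sxyz.
have [|x tx xyz] := spectrum_mul_left (z := z)
    (principal_lattice_filter s4t) (pfilter_filter (spectrumP y)).
  move=> a b ta yb; apply: yz; apply: spectrum_up yb.
  by rewrite -{1}(s4mul_tl b) s4mul_le.
by exists x => //; apply: tx => /=.
Qed.

(** Every compact open is some [stone a], so the closure conditions reduce to the identities above.
    The definition is transparent because facts about [spectrum A] are later used directly for its
    points. *)
Definition dual_space : s4dm_space.
Proof.
refine (@S4DMSpace (spectrum A) spectrum_g spectrum_S spectrum_R (stone s4t)
  (spectrum_spectral A) _ _ _ _ _ _ _ _ _ _ _
  (stone_compact_open s4t) spectrum_Theta).
- move=> x; apply: spectrum_ext => a /=; rewrite s4negK.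
  by split=> [/contrapT|? /(_ _)].
- move=> x y /spec_le_spectrum xy; apply/spec_le_spectrum => a /=.
  by apply: contra_not; exact: xy.
- by move=> x a; apply: spectrum_up; exact: s4nabla_ge.
- move=> x y z xy yz a /xy/yz; apply: spectrum_up; exact: s4nabla_nabla.
- move=> _ /compact_open_stone[a ->].
  by rewrite spectrum_star; exact: stone_compact_open.
- move=> _ /compact_open_stone[a ->].
  by rewrite spectrum_nabla; exact: stone_compact_open.
- move=> _ _ /compact_open_stone[a ->] /compact_open_stone[b ->].
  by rewrite spectrum_fusion; exact: stone_compact_open.
- move=> _ _ /compact_open_stone[a ->] /compact_open_stone[b ->].
  by rewrite spectrum_imp; exact: stone_compact_open.
- move=> x y /existsNP[a /not_implyP[xa ya]].
  exists (stone a); split=> //; first exact: stone_compact_open.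
  by rewrite spectrum_nabla.
- move=> x y z x' y' z' Sxyz /spec_le_spectrum x'x /spec_le_spectrum y'y
    /spec_le_spectrum zz' a b x'a y'b.
  by apply: zz'; apply: Sxyz; [exact: x'x|exact: y'y].
- move=> x y z /existsNP[a /existsNP[b /not_implyP[xa /not_implyP[yb zab]]]].
  exists (stone a), (stone b); split=> //; try exact: stone_compact_open.
  by rewrite spectrum_fusion.
Defined.

End DualSpace.

(** * Spectral frame morphisms from homomorphisms *)

Section DualMap.
Context (A B : s4dm_groupoid) (h : s4dm_hom A B).
Let hP := s4dm_homP h.

Lemma s4dm_hom_le (a b : A) : (a <= b)%O -> (h a <= h b)%O.
Proof. by move=> /meet_l <-; rewrite (s4hom_meet hP) leIr. Qed.

(** The filter generated by the image of [x]. It is in general not prime, which is why the extension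
    lemmas start from arbitrary filters. *)
Lemma image_lattice_filter (x : set A) : lattice_filter x ->
  lattice_filter [set b | exists2 a, x a & (h a <= b)%O].
Proof.
move=> fx; split=> [|b c [a xa ab] [e xe ec]|b c bc [a xa ab]].
- by exists \top%O; [exact: lfilter_top fx|exact: lex1].
- exists (a `&` e)%O; first exact: lfilter_meet fx _ _ xa xe.
  by rewrite (s4hom_meet hP) leI2.
- by exists a => //; exact: le_trans ab bc.
Qed.

Lemma preimage_prime_filter (y : spectrum B) : prime_filter (h @^-1` y).
Proof.
split; first split=> [|a b|a b ab] /=.
- by rewrite (s4hom_top hP); exact: spectrum_top.
- by move=> ya yb; rewrite (s4hom_meet hP) spectrum_meet.
- by apply: spectrum_up; exact: s4dm_hom_le.
- by rewrite /= (s4hom_bot hP); exact: spectrum_bot.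
- by move=> a b /=; rewrite (s4hom_join hP) spectrum_join.
Qed.

Definition preimage_spectrum (y : dual_space B) : dual_space A :=
  Spectrum (preimage_prime_filter y).

Lemma preimage_spectrum_stone (a : A) :
  preimage_spectrum @^-1` stone a = stone (h a).
Proof. by []. Qed.

Lemma is_spectral_frame_mor_preimage : is_spectral_frame_mor preimage_spectrum.
Proof.
split.
- move=> _ /compact_open_stone[a ->].
  by rewrite preimage_spectrum_stone; exact: stone_compact_open.
- by rewrite preimage_spectrum_stone (s4hom_t hP).
- by move=> y; apply: spectrum_ext => a /=; rewrite (s4hom_neg hP).
- by move=> x y z Sxyz a b xa yb /=; rewrite (s4hom_mul hP); exact: Sxyz.
(* The images of [x'] and [y'] generate filters whose products lie in [z], as [h] preserves
   products. *)
- move=> x' y' z Sz.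
  have [|||x [y [Sxyz xx' yy']]] := @spectrum_S_extend B
    [set b | exists2 a, x' a & (h a <= b)%O]
    [set b | exists2 a, y' a & (h a <= b)%O] z.
  + exact: image_lattice_filter (pfilter_filter (spectrumP x')).
  + exact: image_lattice_filter (pfilter_filter (spectrumP y')).
  + move=> a b [a' xa' aa'] [b' yb' bb'].
    have /= := Sz _ _ xa' yb'; rewrite (s4hom_mul hP); apply: spectrum_up.
    exact: s4mul_le.
  exists x, y; split=> //; apply/spec_le_spectrum => a xa.
    by apply: xx'; exists a.
  by apply: yy'; exists a.
(* The complement of [z'] is an ideal; avoiding the ideal generated by its image forces the preimage
   of [z] into [z']. *)
- move=> x y' z' Sx.
  have [|||y [z [Sxyz yy' zI]]] := @spectrum_S_avoid B x
    [set b | exists2 a, y' a & (h a <= b)%O]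
    [set b | exists2 a, ~ z' a & (b <= h a)%O].
  + exact: image_lattice_filter (pfilter_filter (spectrumP y')).
  + split=> [|a b [c zc ac] [e ze be]|a b ab [c zc bc]].
    * by exists \bot%O; [exact: spectrum_bot|exact: le0x].
    * exists (c `|` e)%O; first by rewrite spectrum_join => -[].
      by rewrite (s4hom_join hP) leU2.
    * by exists c => //; exact: le_trans bc.
  + move=> c b xc [a ya ab] [e ze cbe]; apply: ze.
    (* Residuation moves [h a] across, and preservation of [s4imp] brings the result back into [A],
       where [y'] and [z'] can be used. *)
    have xae : preimage_spectrum x (s4imp a e).
      apply: spectrum_up xc; rewrite (s4hom_imp hP); apply/s4residuation.
      by apply: le_trans cbe; exact: s4mul_le.
    by apply: spectrum_up (Sx _ _ xae ya); exact/s4residuation.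
  exists y, z; split=> //; apply/spec_le_spectrum => a.
    by move=> ya; apply: yy'; exists a.
  by move=> /zI zha; apply: contrapT => za; apply: zha; exists a.
- move=> _ /compact_open_stone[a ->].
  rewrite preimage_spectrum_stone !spectrum_nabla preimage_spectrum_stone.
  by rewrite (s4hom_nabla hP).
Qed.

Definition dual_map : spectral_frame_mor (dual_space B) (dual_space A) :=
  SpectralFrameMor is_spectral_frame_mor_preimage.

End DualMap.

Definition dual_space_functor : functor (opposite S4DMGrp) S4DMGrpSpec.
Proof.
refine (@Functor (opposite S4DMGrp) S4DMGrpSpec dual_space
  (fun A B (h : s4dm_hom B A) => dual_map h) _ _).
- move=> A; apply: spectral_frame_mor_ext; apply/funext => x.
  exact: spectrum_ext.
- move=> A B C h k; apply: spectral_frame_mor_ext; apply/funext => x.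
  exact: spectrum_ext.
Defined.

(** * The dual algebra of a space *)

(** A type of its own, so that it can carry lattice instances. *)
Record compact_opens (X : s4dm_space) := CompactOpens {
  compact_opens_set :> X -> Prop;
  compact_opensP : compact_open_sets X compact_opens_set
}.

HB.instance Definition _ (X : s4dm_space) := gen_eqMixin (compact_opens X).
HB.instance Definition _ (X : s4dm_space) := gen_choiceMixin (compact_opens X).

Section CompactOpens.
Context (X : s4dm_space).
Implicit Types U V W : compact_opens X.

Lemma compact_opens_ext U V : (forall x, U x <-> V x) -> U = V.
Proof.
case: U V => U coU [V coV] /= UV.
have {}UV : U = V by apply/funext => x; exact/propext.
by subst V; rewrite (Prop_irrelevance coU coV).
Qed.

Lemma compact_opens_up U x y : spec_le x y -> U x -> U y.
Proof. by apply; case: (compact_opensP U). Qed.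

Definition compact_opens_meet U V : compact_opens X :=
  CompactOpens (spectral_setI (s4sp_spectral X)
    (compact_opensP U) (compact_opensP V)).

Lemma compact_open_setsU U V : compact_open_sets X (U `|` V).
Proof.
have [cU oU] := compact_opensP U; have [cV oV] := compact_opensP V.
by split; [exact: compactU|exact: openU].
Qed.

Definition compact_opens_join U V : compact_opens X :=
  CompactOpens (compact_open_setsU U V).

Definition compact_opens_bot : compact_opens X :=
  CompactOpens (conj (@compact0 X) (@open0 X)).

Definition compact_opens_top : compact_opens X :=
  CompactOpens (conj (spectral_compact (s4sp_spectral X)) (@openT X)).

Definition compact_opens_le U V : bool := `[< forall x, U x -> V x >].

Lemma compact_opens_le_def U V :
  compact_opens_le U V = (compact_opens_meet U V == U).
Proof.
apply/asboolP/eqP => [UV|<- x [] //].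
by apply: compact_opens_ext => x; split=> [[]//|Ux]; split=> //; exact: UV.
Qed.

Lemma compact_opens_meetC : commutative compact_opens_meet.
Proof. by move=> U V; apply: compact_opens_ext => x /=; tauto. Qed.

Lemma compact_opens_joinC : commutative compact_opens_join.
Proof. by move=> U V; apply: compact_opens_ext => x /=; tauto. Qed.

Lemma compact_opens_meetA : associative compact_opens_meet.
Proof. by move=> U V W; apply: compact_opens_ext => x /=; tauto. Qed.

Lemma compact_opens_joinA : associative compact_opens_join.
Proof. by move=> U V W; apply: compact_opens_ext => x /=; tauto. Qed.

Lemma compact_opens_joinKI V U :
  compact_opens_meet U (compact_opens_join U V) = U.
Proof. by apply: compact_opens_ext => x /=; tauto. Qed.

Lemma compact_opens_meetKU V U :
  compact_opens_join U (compact_opens_meet U V) = U.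
Proof. by apply: compact_opens_ext => x /=; tauto. Qed.

Lemma compact_opens_meetUl :
  left_distributive compact_opens_meet compact_opens_join.
Proof. by move=> U V W; apply: compact_opens_ext => x /=; tauto. Qed.

Lemma compact_opens_meetxx : idempotent_op compact_opens_meet.
Proof. by move=> U; apply: compact_opens_ext => x /=; tauto. Qed.

Lemma compact_opens_bot_le U : compact_opens_le compact_opens_bot U.
Proof. exact/asboolP. Qed.

Lemma compact_opens_le_top U : compact_opens_le U compact_opens_top.
Proof. exact/asboolP. Qed.

End CompactOpens.

Fact compact_opens_display : Order.disp_t. Proof. exact: Order.Disp tt tt. Qed.

HB.instance Definition _ (X : s4dm_space) :=
  Order.isMeetJoinDistrLattice.Build compact_opens_display (compact_opens X)
    (@compact_opens_le_def X) (fun _ _ => erefl)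
    (@compact_opens_meetC X) (@compact_opens_joinC X)
    (@compact_opens_meetA X) (@compact_opens_joinA X)
    (@compact_opens_joinKI X) (@compact_opens_meetKU X)
    (@compact_opens_meetUl X) (@compact_opens_meetxx X).
HB.instance Definition _ (X : s4dm_space) :=
  Order.hasBottom.Build compact_opens_display (compact_opens X)
    (@compact_opens_bot_le X).
HB.instance Definition _ (X : s4dm_space) :=
  Order.hasTop.Build compact_opens_display (compact_opens X)
    (@compact_opens_le_top X).

Section DualAlgebra.
Context (X : s4dm_space).
Implicit Types U V W : compact_opens X.

Lemma compact_opens_leP U V : (U <= V)%O <-> (forall x, U x -> V x).
Proof. by split=> [/asboolP|?]; [|exact/asboolP]. Qed.

Definition compact_opens_star U : compact_opens X :=
  CompactOpens (s4sp_star (compact_opensP U)).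

Definition compact_opens_nabla U : compact_opens X :=
  CompactOpens (s4sp_nabla (compact_opensP U)).

Definition compact_opens_fusion U V : compact_opens X :=
  CompactOpens (s4sp_fusion (compact_opensP U) (compact_opensP V)).

Definition compact_opens_imp U V : compact_opens X :=
  CompactOpens (s4sp_imp (compact_opensP U) (compact_opensP V)).

Definition dual_algebra : s4dm_groupoid.
Proof.
refine (@S4DMGroupoid compact_opens_display (compact_opens X)
  compact_opens_star compact_opens_fusion compact_opens_imp
  (CompactOpens (s4Theta_co X)) compact_opens_nabla
  _ _ _ _ _ _ _ _ _ _ _).
- split=> [U V /compact_opens_leP UV|U].
    by apply/compact_opens_leP => x /=; apply: contra_not; exact: UV.
  apply: compact_opens_ext => x /=; rewrite /set_star /= s4g_inv.
  by split=> [/contrapT|? /(_ _)].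
- move=> U V; apply: compact_opens_ext => y; split=> /=.
    by move=> [x [Ux|Vx] xy]; [left|right]; exists x.
  by move=> [[x Ux xy]|[x Vx xy]]; exists x => //; [left|right].
- by apply: compact_opens_ext => y; split=> // -[].
- move=> U; apply/compact_opens_leP => x Ux.
  by exists x => //; exact: s4R_refl.
- move=> U; apply/compact_opens_leP => z [y [x Ux xy] yz].
  by exists x => //; exact: s4R_trans xy yz.
(* Left unit: one inclusion holds because open sets are up-sets, the other because reflexivity of
   the order supplies an [x] in [s4Theta X] with [s4S x z z]. *)
- move=> U; apply: compact_opens_ext => z; split=> /=.
    move=> [x [y [Sxyz Tx Uy]]]; apply: compact_opens_up Uy.
    by apply/s4ThetaP; exists x.
  move=> Uz; have [x Tx Sxzz] : exists2 x, s4Theta X x & s4S x z z.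
    exact/s4ThetaP.
  by exists x, z.
- by move=> U; apply: compact_opens_ext => z; split=> // -[x [y []]].
- by move=> U; apply: compact_opens_ext => z; split=> // -[x [y []]].
- move=> U V W; apply: compact_opens_ext => z; split=> /=.
    by move=> [x [y [Sxyz Ux [Vy|Wy]]]]; [left|right]; exists x, y.
  move=> [[x [y [Sxyz Ux Vy]]]|[x [y [Sxyz Ux Wy]]]]; exists x, y.
    by split=> //; left.
  by split=> //; right.
- move=> U V W; apply: compact_opens_ext => z; split=> /=.
    by move=> [x [y [Sxyz [Ux|Vx] Wy]]]; [left|right]; exists x, y.
  move=> [[x [y [Sxyz Ux Wy]]]|[x [y [Sxyz Vx Wy]]]]; exists x, y.
    by split=> //; left.
  by split=> //; right.
- move=> U V W; split=> /compact_opens_leP UVW; apply/compact_opens_leP.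
    by move=> x Ux y z [Sxyz Vy]; apply: UVW; exists x, y.
  by move=> z [x [y [Sxyz Ux Vy]]]; exact: (UVW x Ux y z).
Defined.

End DualAlgebra.

(** * Homomorphisms from spectral frame morphisms *)

Section DualHom.
Context (X Y : s4dm_space) (f : spectral_frame_mor X Y).
Let fP := sfmP f.

Definition preimage_compact_opens (U : dual_algebra Y) : dual_algebra X :=
  CompactOpens (sfm_spectral fP (compact_opensP U)).

(** For fusion and implication, preservation of [s4S] gives one inclusion and the back or forth
    condition the other; the inequalities in the latter are absorbed since compact opens are
    up-sets. *)
Lemma is_s4dm_hom_preimage : is_s4dm_hom preimage_compact_opens.
Proof.
split=> [U V|U V|U|U V|U V||||U].
- exact: compact_opens_ext.
- exact: compact_opens_ext.
- apply: compact_opens_ext => x /=.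
  by rewrite /set_star /= (sfm_g fP).
- apply: compact_opens_ext => z; split=> /=.
    move=> [x' [y' [Sz Ux' Vy']]].
    have [x [y [Sxyz xx' yy']]] := sfm_S_back fP Sz.
    by exists x, y; split=> //; [apply: compact_opens_up Ux'
      |apply: compact_opens_up Vy'].
  move=> [x [y [Sxyz Ux Vy]]]; exists (f x), (f y); split=> //.
  exact: sfm_S fP _ _ _ Sxyz.
- apply: compact_opens_ext => x; split=> /=.
    move=> UV y z [Sxyz Uy]; apply: (UV (f y) (f z)); split=> //.
    exact: sfm_S fP _ _ _ Sxyz.
  move=> UV y' z' [Sx Uy'].
  have [y [z [Sxyz yy' zz']]] := sfm_S_forth fP Sx.
  apply: compact_opens_up zz' _; apply: (UV y z); split=> //.
  exact: compact_opens_up yy' Uy'.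
- apply: compact_opens_ext => x /=.
  by rewrite -(sfm_Theta fP).
- exact: compact_opens_ext.
- exact: compact_opens_ext.
- apply: compact_opens_ext => x /=.
  by rewrite -(sfm_nabla fP (compact_opensP U)).
Qed.

Definition dual_hom : s4dm_hom (dual_algebra Y) (dual_algebra X) :=
  S4DMHom is_s4dm_hom_preimage.

End DualHom.

Definition dual_algebra_functor : functor S4DMGrpSpec (opposite S4DMGrp).
Proof.
refine (@Functor S4DMGrpSpec (opposite S4DMGrp) dual_algebra
  (fun X Y (f : spectral_frame_mor X Y) => dual_hom f) _ _).
- move=> X; apply: s4dm_hom_ext; apply/funext => U.
  exact: compact_opens_ext.
- move=> X Y Z f g; apply: s4dm_hom_ext; apply/funext => U.
  exact: compact_opens_ext.
Defined.

(** * Unit and counit *)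

Section Unit.
Context (A : s4dm_groupoid).

Definition stone_compact_opens (a : A) : dual_algebra (dual_space A) :=
  @CompactOpens (dual_space A) (stone a) (stone_compact_open a).

Lemma is_s4dm_hom_stone : is_s4dm_hom stone_compact_opens.
Proof.
split=> [a b|a b|a|a b|a b||||a]; apply: compact_opens_ext => x /=.
- by rewrite stoneI.
- by rewrite stoneU.
- by rewrite spectrum_star.
- by rewrite spectrum_fusion.
- by rewrite spectrum_imp.
- by [].
- by rewrite stone0.
- by rewrite stoneT.
- by rewrite spectrum_nabla.
Qed.

Definition unit_hom : s4dm_hom A (dual_algebra (dual_space A)) :=
  S4DMHom is_s4dm_hom_stone.

Lemma unit_hom_inj : injective unit_hom.
Proof.
by move=> a b /(congr1 (@compact_opens_set _)); exact: stone_inj.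
Qed.

Lemma unit_hom_surj (U : dual_algebra (dual_space A)) :
  exists a, unit_hom a = U.
Proof.
have [a Ua] := compact_open_stone (compact_opensP U).
by exists a; apply: compact_opens_ext => x /=; rewrite -Ua.
Qed.

End Unit.

Section InverseHom.
Context (A B : s4dm_groupoid) (h : s4dm_hom A B) (k : B -> A).
Hypotheses (hK : cancel h k) (kK : cancel k h).

Lemma is_s4dm_hom_can : is_s4dm_hom k.
Proof.
have hP := s4dm_homP h.
split=> [a b|a b|a|a b|a b||||a]; apply: (can_inj hK); rewrite kK.
- by rewrite (s4hom_meet hP) !kK.
- by rewrite (s4hom_join hP) !kK.
- by rewrite (s4hom_neg hP) !kK.
- by rewrite (s4hom_mul hP) !kK.
- by rewrite (s4hom_imp hP) !kK.
- by rewrite (s4hom_t hP).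
- by rewrite (s4hom_bot hP).
- by rewrite (s4hom_top hP).
- by rewrite (s4hom_nabla hP) !kK.
Qed.

End InverseHom.

(** A preimage picked by choice; injectivity of [unit_hom] makes it a two-sided inverse. *)
Definition unit_inv_fun (A : s4dm_groupoid)
    (U : dual_algebra (dual_space A)) : A := sval (cid (unit_hom_surj U)).

Lemma unit_inv_funK A : cancel (@unit_inv_fun A) (unit_hom A).
Proof. by move=> U; rewrite /unit_inv_fun; case: cid. Qed.

Lemma unit_homK A : cancel (unit_hom A) (@unit_inv_fun A).
Proof. by move=> a; apply: unit_hom_inj; rewrite unit_inv_funK. Qed.

Definition unit_inv (A : s4dm_groupoid) :
    s4dm_hom (dual_algebra (dual_space A)) A :=
  S4DMHom (is_s4dm_hom_can (@unit_homK A) (@unit_inv_funK A)).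

(** In the opposite category an arrow from the double dual to [A] is a homomorphism out of [A], so
    [unit_hom] is the forward component. *)
Lemma unit_natural_iso : natural_iso
  (functor_comp dual_space_functor dual_algebra_functor)
  (functor_id (opposite S4DMGrp)).
Proof.
unshelve refine (@NaturalIso (opposite S4DMGrp) (opposite S4DMGrp)
  (functor_comp dual_space_functor dual_algebra_functor) (functor_id _)
  unit_hom unit_inv _ _ _).
- move=> A; apply: s4dm_hom_ext; apply/funext => U; exact: unit_inv_funK.
- move=> A; apply: s4dm_hom_ext; apply/funext => a; exact: unit_homK.
- move=> A B h; apply: s4dm_hom_ext; apply/funext => a.
  exact: compact_opens_ext.
Qed.

(** * Points as prime filters of compact opens *)

Section Counit.
Context (X : s4dm_space).
Let sX := s4sp_spectral X.

Lemma counit_prime_filter (x : X) :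
  prime_filter [set U : dual_algebra X | U x].
Proof.
by split=> //; split=> // U V /compact_opens_leP; apply.
Qed.

Definition counit (x : X) : dual_space (dual_algebra X) :=
  Spectrum (counit_prime_filter x).

Lemma compact_open_nbhs (x : X) (U : set X) : open U -> U x ->
  exists2 V : compact_opens X, V x & V `<=` U.
Proof.
move=> oU Ux; have [_ /(_ x U)] := spectral_basis sX.
case; first by apply: open_nbhs_nbhs; split.
by move=> V [coV Vx] VU; exists (CompactOpens coV).
Qed.

Lemma counit_le (x y : X) : spec_le (counit x) (counit y) <-> spec_le x y.
Proof.
rewrite spec_le_spectrum; split=> [xy U oU Ux|xy U]; last first.
  exact: compact_opens_up.
by have [V Vx VU] := compact_open_nbhs oU Ux; apply: VU; exact: xy.
Qed.

(** Points with the same compact open neighbourhoods specialize to each other, which T0 forbids for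
    distinct points. *)
Lemma counit_inj : injective counit.
Proof.
move=> x y xy; apply: contrapT => /eqP nxy.
have le_counit z z' : counit z = counit z' -> spec_le z z'.
  by move=> zz'; apply/counit_le; rewrite zz'.
have [N [|]] := spectral_T0 sX nxy; rewrite !inE nbhsE.
  move=> [[U [oU Ux] UN] Ny]; apply/Ny/UN.
  exact: le_counit xy U oU Ux.
move=> [[U [oU Uy] UN] Nx]; apply/Nx/UN.
exact: le_counit (esym xy) U oU Uy.
Qed.

(** The open sets including a member of [P] form a completely prime filter, and sobriety provides
    its point. *)
Lemma counit_surj (P : dual_space (dual_algebra X)) : exists x, counit x = P.
Proof.
pose F : set (set X) :=
  [set U | open U /\ exists2 V : compact_opens X, P V & V `<=` U].
have cF : completely_prime_filter F.
  split=> [U []//||U V|U V [_ [W PW WU]] oV UV|G oG].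
  - split; first exact: openT.
    by exists \top%O => //; exact: spectrum_top.
  - move=> [oU [U' PU' UU]] [oV [V' PV' VV]]; split; first exact: openI.
    exists (U' `&` V')%O; first by apply/spectrum_meet.
    exact: setISS UU VV.
  - by split=> //; exists W => // x /WU/UV.
  (* If no member of [G] were in [F], the compact opens outside [P] would cover [V]. They are
     directed because [P] is prime, so by compactness one of them would contain [V] and hence belong
     to [P]. *)
  - move=> [_ [V PV VG]]; apply: contrapT => nG.
    pose J : set (set X) := [set (W : X -> Prop) | W in [set W | ~ P W]].
    have [|||x /VG[U GU Ux]|W [W' PW' <-] VW] :=
        @compact_directed_cover _ V J (proj1 (compact_opensP V)).
    + by move=> _ [W _ <-]; have [] := compact_opensP W.
    + by exists set0, \bot%O => //=; exact: spectrum_bot.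
    + move=> _ _ [W PW <-] [W' PW' <-].
      exists (W `|` W')%O => //; exists (W `|` W')%O => //=.
      by rewrite spectrum_join => -[].
    + have [W Wx WU] := compact_open_nbhs (oG _ GU) Ux.
      exists W => //; exists W => //= PW; apply: nG; exists U => //.
      by split; [exact: oG|exists W].
    + apply: PW'; apply: spectrum_up PV; exact/compact_opens_leP.
have [x Fx] := spectral_sober sX cF; exists x.
apply: spectrum_ext => U; split=> [Ux|PU].
  have : F U by rewrite Fx; split=> //; have [] := compact_opensP U.
  by move=> [_ [V PV VU]]; apply: spectrum_up PV; exact/compact_opens_leP.
have : F U by split; [have [] := compact_opensP U|exists U].
by rewrite Fx => -[].
Qed.

(** Reflection is the contrapositive of the separation axiom [s4S_sep]. *)
Lemma counit_S (x y z : X) : s4S (counit x) (counit y) (counit z) <-> s4S x y z.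
Proof.
split=> [Sc|Sxyz U V Ux Vy]; last by exists x, y.
apply: contrapT => /s4S_sep[U [V [coU coV Ux Vy]]]; apply.
exact: (Sc (CompactOpens coU) (CompactOpens coV)).
Qed.

Lemma counit_R (x y : X) : s4R (counit x) (counit y) <-> s4R x y.
Proof.
split=> [Rc|Rxy U Ux]; last by exists x.
apply: contrapT => /s4R_sep[U [coU Ux]]; apply.
exact: (Rc (CompactOpens coU)).
Qed.

Lemma counit_g (x : X) : counit (s4g x) = s4g (counit x).
Proof.
apply: spectrum_ext => U; rewrite /= /set_star /=.
by split=> [? /(_ _)|/contrapT].
Qed.

End Counit.

Section RelationalIso.
Context (X Y : s4dm_space) (f : X -> Y) (k : Y -> X).
Hypotheses (fK : cancel f k) (kK : cancel k f) (sf : spectral_map f).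
Hypothesis fTheta : f @^-1` s4Theta Y = s4Theta X.
Hypothesis fg : forall x, f (s4g x) = s4g (f x).
Hypothesis fS : forall x y z, s4S (f x) (f y) (f z) <-> s4S x y z.
Hypothesis fR : forall x y, s4R (f x) (f y) <-> s4R x y.

(** The inverse [k] supplies the back and forth witnesses, so the required inequalities become
    equalities. It is applied to [counit] and to its inverse alike. *)
Lemma is_spectral_frame_mor_iso : is_spectral_frame_mor f.
Proof.
split=> // [x y z /fS//|x' y' z Sz|x y' z' Sx|U _].
- exists (k x'), (k y'); rewrite !kK; split=> //.
  by apply/fS; rewrite !kK.
- exists (k y'), (k z'); rewrite !kK; split=> //.
  by apply/fS; rewrite !kK.
- apply/seteqP; split=> y [x Ux Rxy]; last by exists (f x) => //; apply/fR.
  by exists (k x); rewrite /= ?kK //; apply/fR; rewrite kK.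
Qed.

End RelationalIso.

Section CounitIso.
Context (X : s4dm_space).

Definition counit_inv (P : dual_space (dual_algebra X)) : X :=
  sval (cid (counit_surj P)).

Lemma counit_invK : cancel counit_inv (@counit X).
Proof. by move=> P; rewrite /counit_inv; case: cid. Qed.

Lemma counit_invE (P : dual_space (dual_algebra X)) (U : dual_algebra X) :
  P U <-> U (counit_inv P).
Proof. by rewrite -{1}(counit_invK P). Qed.

Lemma counitK : cancel (@counit X) counit_inv.
Proof. by move=> x; apply: counit_inj; rewrite counit_invK. Qed.

Lemma is_spectral_frame_mor_counit : is_spectral_frame_mor (@counit X).
Proof.
apply: (is_spectral_frame_mor_iso counit_invK).
- move=> _ /compact_open_stone[U ->]; exact: compact_opensP U.
- by [].
- exact: counit_g.
- exact: counit_S.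
- exact: counit_R.
Qed.

Lemma is_spectral_frame_mor_counit_inv : is_spectral_frame_mor counit_inv.
Proof.
apply: (is_spectral_frame_mor_iso counitK).
- move=> U coU.
  (* A prime filter contains [U] exactly when the point it comes from lies in [U]. *)
  suff -> : counit_inv @^-1` U = stone (CompactOpens coU : dual_algebra X).
    exact: stone_compact_open.
  by apply/seteqP; split=> P; apply (counit_invE P (CompactOpens coU)).
- apply/seteqP; split=> P;
    apply (counit_invE P (CompactOpens (s4Theta_co X))).
- by move=> P; apply: counit_inj; rewrite counit_g !counit_invK.
- by move=> P Q T; rewrite -counit_S !counit_invK.
- by move=> P Q; rewrite -counit_R !counit_invK.
Qed.

Definition counit_mor : spectral_frame_mor X (dual_space (dual_algebra X)) :=
  SpectralFrameMor is_spectral_frame_mor_counit.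

Definition counit_inv_mor :
    spectral_frame_mor (dual_space (dual_algebra X)) X :=
  SpectralFrameMor is_spectral_frame_mor_counit_inv.

End CounitIso.

Lemma counit_natural_iso : natural_iso
  (functor_comp dual_algebra_functor dual_space_functor)
  (functor_id S4DMGrpSpec).
Proof.
unshelve refine (@NaturalIso S4DMGrpSpec S4DMGrpSpec
  (functor_comp dual_algebra_functor dual_space_functor) (functor_id _)
  counit_inv_mor counit_mor _ _ _).
- move=> X; apply: spectral_frame_mor_ext; apply/funext => P.
  exact: counit_invK.
- move=> X; apply: spectral_frame_mor_ext; apply/funext => x.
  exact: counitK.
- move=> X Y f; apply: spectral_frame_mor_ext; apply/funext => P /=.
  (* After applying [counit], both sides are the filter of compact opens whose preimage under [f]
     contains [counit_inv P]. *)
  apply: counit_inj; rewrite counit_invK -{1}(counit_invK P).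
  exact: spectrum_ext.
Qed.

Theorem theorem4p26 : dually_equivalent S4DMGrp S4DMGrpSpec.
Proof.
exists dual_space_functor, dual_algebra_functor.
by split; constructor; [exact: unit_natural_iso|exact: counit_natural_iso].
Qed.
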